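(* Let $p(x)$ and $q(x)$ be real polynomials of degree at most $2$ and at most $1$, respectively. Let $n \ge 1$ and let $x_1, \dots, x_n$ be distinct real numbers contained in the domain of definition $I \subseteq \mathbb{R}$ of the differential equation below. Then $$ p(x_i) \sum_{\substack{k=1 \\ k \neq i}}^{n} \frac{2}{x_i - x_k} = q(x_i) - p'(x_i) \qquad \text{for all } 1 \le i \le n $$ if and only if there exists $\lambda \in \mathbb{R}$ such that the polynomial $y(x) = \prod_{k=1}^{n} (x - x_k)$ solves $$ -(p(x) y'(x))' + q(x) y'(x) = \lambda y(x). $$
   Context: The domain of definition $I$ is the real interval on which the differential equation is considered. It may be bounded or unbounded (e.g. all of $\mathbb{R}$), and no further restriction is placed on it. No orthogonality and no sign condition on $p$ are assumed. For $n=1$ the empty sum is $0$. *)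

(* Defs.v *)
From HB Require Import structures.
From mathcomp Require Import all_boot all_order all_algebra.
From mathcomp Require Import reals.

Set Implicit Arguments.
Unset Strict Implicit.
Unset Printing Implicit Defensive.

Import Order.TTheory GRing.Theory Num.Theory.

Local Open Scope ring_scope.

Definition nodal_poly (R : realType) (n : nat) (x : 'I_n -> R) : {poly R} :=
  \prod_(k < n) ('X - (x k)%:P).

(* The equation  -(p y')' + q y' = lambda y  is required pointwise, at the
   points of the interval I on which it is considered. Since p and y are
   polynomials, the derivatives are those of the polynomials; in particular
   nothing special happens at an endpoint belonging to I. *)
Definition solves_ode (R : realType) (I : interval R) (p q : {poly R})
    (lambda : R) (y : {poly R}) : Prop :=
  forall t : R, t \in I ->
    - ((p * y^`())^`()).[t] + q.[t] * (y^`()).[t] = lambda * y.[t].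

(* Main.v *)
Require Import Defs.
From HB Require Import structures.
From mathcomp Require Import all_boot all_order all_algebra.
From mathcomp Require Import reals.
From mathcomp Require Import ring zify.

Set Implicit Arguments.
Unset Strict Implicit.
Unset Printing Implicit Defensive.

Import Order.TTheory GRing.Theory Num.Theory.

Local Open Scope ring_scope.

(* At a node, y'' / y' = \sum_(k != i) 2 / (x i - x k), so the algebraic
   relations say exactly that L = - (p y')' + q y' vanishes at every node.
   The degree bounds give deg L <= n = deg y, hence L is then a scalar
   multiple of y. The converse only evaluates the equation at the nodes,
   which is why they have to lie in I. *)

(** Logarithmic derivative of a product of linear factors; [ht] keeps [t] off the roots, so every
    inverse is a genuine one. *)
Lemma horner_deriv_prod_XsubC (F : fieldType) (J : Type) (r : seq J)
    (P : pred J) (x : J -> F) (t : F) (ht : forall k, P k -> t != x k) :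
  ((\prod_(k <- r | P k) ('X - (x k)%:P))^`()).[t]
  = (\prod_(k <- r | P k) ('X - (x k)%:P)).[t]
    * \sum_(k <- r | P k) (t - x k)^-1.
Proof.
elim/big_rec2: _ => [|k s z Pk IH]; first by rewrite derivC horner0 mulr0.
have tk : t - x k != 0 by rewrite subr_eq0 ht.
by rewrite derivM derivXsubC !hornerE IH; field.
Qed.

Lemma nodal_polyD1 (R : realType) (n : nat) (x : 'I_n -> R) (i : 'I_n) :
  nodal_poly x
  = ('X - (x i)%:P) * \prod_(k < n | k != i) ('X - (x k)%:P).
Proof. by rewrite /nodal_poly (bigD1 i). Qed.

Lemma root_nodal_poly (R : realType) (n : nat) (x : 'I_n -> R) (i : 'I_n) :
  (nodal_poly x).[x i] = 0.
Proof. by rewrite (nodal_polyD1 x i) !hornerE subrr mul0r. Qed.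

Lemma size_nodal_poly (R : realType) (n : nat) (x : 'I_n -> R) :
  size (nodal_poly x) = n.+1.
Proof. by rewrite /nodal_poly -big_enum size_prod_XsubC size_enum_ord. Qed.

Lemma nodal_poly_monic (R : realType) (n : nat) (x : 'I_n -> R) :
  nodal_poly x \is monic.
Proof. exact: monic_prod_XsubC. Qed.

(** Distinct nodes are simple roots: the derivative at [x i] is the product of the other factors
    there. *)
Lemma deriv_nodal_poly_neq0 (R : realType) (n : nat) (x : 'I_n -> R)
    (x_distinct : injective x) (i : 'I_n) :
  ((nodal_poly x)^`()).[x i] != 0.
Proof.
rewrite (nodal_polyD1 x i) derivM derivXsubC !hornerE subrr mul0r addr0.
rewrite horner_prod; apply/prodf_neq0 => k ki.
by rewrite !hornerE subr_eq0 (inj_eq x_distinct) eq_sym.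
Qed.

(** With y = (X - x_i) g, one has y'(x_i) = g(x_i) and y''(x_i) = 2 g'(x_i); the logarithmic
    derivative of g gives the sum. *)
Lemma deriv2_nodal_poly (R : realType) (n : nat) (x : 'I_n -> R)
    (x_distinct : injective x) (i : 'I_n) :
  ((nodal_poly x)^`()^`()).[x i]
  = ((nodal_poly x)^`()).[x i] * \sum_(k < n | k != i) 2 / (x i - x k).
Proof.
rewrite (nodal_polyD1 x i) derivM derivXsubC mul1r derivD derivM derivXsubC.
rewrite mul1r !hornerE.
rewrite horner_deriv_prod_XsubC => [|k ki]; last first.
  by rewrite (inj_eq x_distinct) eq_sym.
by rewrite -mulr_sumr /=; ring.
Qed.

(** The left-hand side L as a polynomial, so that its size and coefficients are available and not
    only its values on [I]. *)
Definition ode_poly (R : realType) (p q y : {poly R}) : {poly R} :=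
  - (p * y^`())^`() + q * y^`().

Lemma horner_ode_poly (R : realType) (p q y : {poly R}) (t : R) :
  (ode_poly p q y).[t] = - ((p * y^`())^`()).[t] + q.[t] * (y^`()).[t].
Proof. by rewrite /ode_poly !hornerE. Qed.

Lemma size_ode_poly (R : realType) (p q y : {poly R}) :
  (size p <= 3)%N -> (size q <= 2)%N -> (size (ode_poly p q y) <= size y)%N.
Proof.
move=> hp hq; have [->|y0] := eqVneq y 0.
  by rewrite /ode_poly deriv0 !mulr0 deriv0 oppr0 addr0.
have size_y' : (size y^`() < size y)%N by exact: lt_size_deriv.
(* Here [m] bounds the degree of [r]: it is 1 for [q] and 2 for [p], where the outer derivative
   removes the extra degree. *)
have sizeM m (r : {poly R}) : (size r <= m.+1)%N ->
    (size (r * y^`())%R < m + size y)%N.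
  by move=> hr; have := size_polyMleq r y^`(); lia.
apply: leq_trans (size_polyD _ _) _; rewrite size_polyN geq_max; apply/andP.
split; last by have := sizeM 1%N q hq; lia.
(* Differentiation strictly lowers the size only of a nonzero polynomial. *)
have [->|py0] := eqVneq (p * y^`()) 0; first by rewrite deriv0 size_poly0.
by rewrite -2!ltnS; apply: leq_ltn_trans (lt_size_deriv py0) (sizeM 2%N p hp).
Qed.

(** L(x_i) is y'(x_i) times the difference of the two sides of the relation, and y'(x_i) is
    nonzero. *)
Lemma node_relationE (R : realType) (p q : {poly R}) (n : nat)
    (x : 'I_n -> R) (x_distinct : injective x) (i : 'I_n) :
  p.[x i] * (\sum_(k < n | k != i) 2 / (x i - x k))
    = q.[x i] - (p^`()).[x i]
  <-> (ode_poly p q (nodal_poly x)).[x i] = 0.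
Proof.
set S := \sum_(k < n | _) _.
have -> : (ode_poly p q (nodal_poly x)).[x i]
    = ((nodal_poly x)^`()).[x i] * (q.[x i] - (p^`()).[x i] - p.[x i] * S).
  by rewrite horner_ode_poly derivM !hornerE deriv2_nodal_poly // -/S; ring.
split=> [->|/eqP]; first by rewrite subrr mulr0.
by rewrite mulf_eq0 (negPf (deriv_nodal_poly_neq0 _ _)) //= subr_eq0 => /eqP.
Qed.

(** The difference of the two sides has [n] distinct roots, yet its size is at most [n]: as y is
    monic, the coefficients of degree [n] cancel. *)
Lemma scale_nodal_polyP (R : realType) (n : nat) (x : 'I_n -> R)
    (x_distinct : injective x) (L : {poly R}) :
  (size L <= n.+1)%N -> (forall i, L.[x i] = 0) ->
  L = L`_n *: nodal_poly x.
Proof.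
move=> size_L rootL; apply/eqP; rewrite -subr_eq0; apply/eqP.
apply: (@roots_geq_poly_eq0 _ _ (codom x)).
- apply/allP => _ /codomP[i ->].
  by rewrite rootE !hornerE rootL root_nodal_poly mulr0 subrr.
- by rewrite map_inj_uniq ?enum_uniq.
rewrite size_codom card_ord; apply/leq_sizeP => j.
rewrite leq_eqVlt coefB coefZ => /predU1P[<-|nj].
  have := nodal_poly_monic x; rewrite monicE lead_coefE size_nodal_poly /=.
  by move/eqP->; rewrite mulr1 subrr.
rewrite (nth_default _ (leq_trans size_L nj)).
by rewrite [(nodal_poly x)`_j]nth_default ?size_nodal_poly // mulr0 subrr.
Qed.

Theorem theorem1 (R : realType) (I : interval R) (p q : {poly R})
    (hp : (size p <= 3)%N) (hq : (size q <= 2)%N)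
    (n : nat) (hn : (1 <= n)%N) (x : 'I_n -> R)
    (x_distinct : injective x) (x_in : forall k : 'I_n, x k \in I) :
  (forall i : 'I_n,
     p.[x i] * (\sum_(k < n | k != i) 2 / (x i - x k))
     = q.[x i] - (p^`()).[x i])
  <-> exists lambda : R, solves_ode I p q lambda (nodal_poly x).
Proof.
split=> [rel|[lambda sol] i]; last first.
  apply/node_relationE => //.
  by rewrite horner_ode_poly sol // root_nodal_poly mulr0.
have Lx i : (ode_poly p q (nodal_poly x)).[x i] = 0 by apply/node_relationE.
have size_L : (size (ode_poly p q (nodal_poly x)) <= n.+1)%N.
  by rewrite -(size_nodal_poly x) size_ode_poly.
(* The eigenvalue is the coefficient of degree [n] in L, since y is monic of degree [n]. *)
exists (ode_poly p q (nodal_poly x))`_n => t _.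
by rewrite -horner_ode_poly {1}(scale_nodal_polyP x_distinct size_L Lx) hornerZ.
Qed.
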